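(* Let $p\geq 3$ be a prime and let $n,k\geq 1$ be integers. Assume that $A\subseteq \mathbb{F}_p^n$ does not admit any $k$-star, that is, there is no tuple $(x_1,x_2,\ldots,x_{2k+1})\in A^{2k+1}$ of $2k+1$ pairwise distinct elements satisfying $x_{2j-1}+x_{2j}-2x_{2k+1}=0$ for all $1\leq j\leq k$. Then $$\#A\leq k^2\,(\Lambda_{1,\frac{1}{3},p-1})^n .$$
   Context: $\#A$ denotes the cardinality of $A$. For $\alpha\in\mathbb{R}_{>0}$ and $m,h\in\mathbb{N}$, $\Lambda_{m,\alpha,h}$ denotes the minimum over $u\in(0,1]$ of the function $G(u)=u^{-\alpha h}(1+u+u^2+\cdots+u^{mh})$. In particular $\Lambda_{1,\frac13,p-1}=\min_{0<u\leq 1}u^{-(p-1)/3}(1+u+\cdots+u^{p-1})$. *)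

(* Defs.v *)
From HB Require Import structures.
From mathcomp Require Import all_boot all_order all_algebra.
From mathcomp Require Import all_classical all_reals all_analysis.

Set Implicit Arguments.
Unset Strict Implicit.
Unset Printing Implicit Defensive.

Import Order.TTheory GRing.Theory Num.Theory.
Import numFieldNormedType.Exports.

Local Open Scope classical_set_scope.
Local Open Scope ring_scope.

(* With 0-based indices, the centre x_(2k+1) is [x`_(2 * k)] and the pair
   x_(2j-1), x_(2j) is [x`_(2 * j)], [x`_(2 * j).+1] with [j < k]. *)
Definition star (p n k : nat) (x : (2 * k).+1.-tuple 'rV['F_p]_n) : Prop :=
  uniq x /\
  forall j : nat, (j < k)%N ->
    x`_(2 * j) + x`_(2 * j).+1 - x`_(2 * k) *+ 2 = 0.

Definition star_free (p n k : nat) (A : {set 'rV['F_p]_n}) : Prop :=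
  ~ exists x : (2 * k).+1.-tuple 'rV['F_p]_n,
      (forall i, tnth x i \in A) /\ star x.

Definition Gfun (R : realType) (m : nat) (alpha : R) (h : nat) (u : R) : R :=
  u `^ (- (alpha * h%:R)) * \sum_(i < (m * h).+1) u ^+ i.

(* [inf] is only used to have a total function: by [Lambda_min] below, it is a
   minimum. *)
Definition Lambda (R : realType) (m : nat) (alpha : R) (h : nat) : R :=
  inf [set Gfun m alpha h u | u in `]0, 1]].

Lemma Gfun_continuous (R : realType) (m : nat) (alpha : R) (h : nat) (u : R) :
  0 < u -> {for u, continuous (Gfun m alpha h)}.
Proof.
move=> u0; apply: continuousM.
- apply/differentiable_continuous/derivable1_diffP.
  by apply: derivable_powR; rewrite in_itv/= u0.
- apply: continuous_big; first exact: add_continuous.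
  by move=> i _; exact: exprn_continuous.
Qed.

Lemma Lambda_min (R : realType) (m : nat) (alpha : R) (h : nat) :
  0 < alpha ->
  exists u : R, [/\ 0 < u <= 1, Lambda m alpha h = Gfun m alpha h u &
    forall v : R, 0 < v <= 1 -> Gfun m alpha h u <= Gfun m alpha h v].
Proof.
move=> alpha0.
suff [u u01 umin] : exists2 u : R, 0 < u <= 1 &
    forall v : R, 0 < v <= 1 -> Gfun m alpha h u <= Gfun m alpha h v.
  exists u; split => //; apply/eqP; rewrite eq_le; apply/andP; split.
    apply: ge_inf.
      by exists (Gfun m alpha h u) => _ [v /= + <-]; rewrite in_itv/= => /umin.
    by exists u => //=; rewrite in_itv.
  apply: lb_le_inf; first by exists (Gfun m alpha h u), u => //=; rewrite in_itv.
  by move=> _ [v /= + <-]; rewrite in_itv/= => /umin.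
have [->|h0] := posnP h.
  exists 1; first by rewrite ltr01 lexx.
  by move=> v _; rewrite /Gfun mulr0 oppr0 !powRr0 muln0 !big_ord1 !expr0.
set s := alpha * h%:R.
have s0 : 0 < s by rewrite mulr_gt0 ?ltr0n.
set C : R := Gfun m alpha h 1.
have C1 : 1 <= C.
  rewrite /C /Gfun powR1 mul1r big_ord_recl expr0 lerDl.
  by apply: sumr_ge0 => i _; rewrite expr1n.
have C0 : 0 < C by apply: lt_le_trans C1.
set d := C `^ (- s^-1).
have d0 : 0 < d by rewrite powR_gt0.
have d1 : d <= 1.
  by rewrite -(powRr0 C) ler_powR// oppr_le0 invr_ge0 ltW.
have dE : d `^ s = C^-1 by rewrite -powRrM mulNr mulVf ?gt_eqF// powR_inv1// ltW.
have [|u] := @EVT_min R (Gfun m alpha h) d 1 d1.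
  apply: continuous_in_subspaceT => v /=; rewrite inE/= in_itv/= => /andP[dv _].
  exact/Gfun_continuous/(lt_le_trans d0).
rewrite in_itv/= => /andP[du u1] umin.
exists u; first by rewrite u1 (lt_le_trans d0).
move=> v /andP[v0 v1]; have [dv|vd] := leP d v.
  by apply: umin; rewrite in_itv/= dv.
have {umin}/le_trans -> // : Gfun m alpha h u <= C.
  by apply: umin; rewrite in_itv/= d1 lexx.
have : C <= v `^ (- s).
  rewrite powRN -[C]invrK lef_pV2 ?posrE ?invr_gt0// ?powR_gt0// -dE.
  by rewrite ge0_ler_powR ?nnegrE ?ltW.
move/le_trans; apply; rewrite /Gfun -/s ler_peMr ?powR_ge0//.
rewrite big_ord_recl expr0 lerDl.
by apply: sumr_ge0 => i _; rewrite exprn_ge0 ?ltW.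
Qed.

(* Main.v *)
Require Import Defs.
From mathcomp Require Import all_boot all_order all_algebra.
From mathcomp Require Import all_classical all_reals all_analysis.
(* [fintype] and [finset] come last so that [subsetP], [setP], [set0], ...
   denote the lemmas about finite sets. *)
From mathcomp Require Import all_field fintype finset ring zify.

(** The proof first removes a bounded proportion of [A] to reach a set without
    nontrivial three-term progressions, then applies the slice-rank method to
    that set and amplifies away the constant with a tensor power.

    _From stars to progressions._  Two pairs with the same centre [x],
    [{y, 2x - y}] and [{y', 2x - y'}], are either equal or disjoint.  Hence [k]
    distinct pairs in [A] with a common centre in [A] form a [k]-star, and in a
    star-free set every [x] is the centre of at most [k - 1] pairs.  Draw an
    arc from [x] to one chosen end of each of these pairs.  The digraph has
    outdegree at most [k - 1], so some vertex has total degree at most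
    [2(k - 1)], in [A] and in each of its subsets; a greedy choice
    ([sparse_digraph_independent_set]) gives an independent [B] in [A] with
    [#|A| <= (2k - 1) #|B| <= k ^ 2 #|B|].  A progression in [B] would contain
    an arc, so [B] has none.

    _Progression-free sets._  On [B], the indicator of [x + y = 2z] is the
    indicator of [x = y = z].  By Fermat's little theorem it is also the
    polynomial [\prod_i (1 - (x_i + y_i - 2 z_i) ^ (p - 1))], a combination
    of products of a monomial in [x], one in [y] and one in [z], of total
    degree at most [n(p - 1)].  In each product one of the three monomials has
    degree at most [n(p - 1)/3].  As the diagonal tensor on [N] points needs at
    least [N] slices ([card_diagonal_tensor]), [#|B|] is at most three times the
    number of monomials of degree at most [n(p - 1)/3] with all exponents below
    [p].  Weighting a monomial of degree [d] by [u ^ d] bounds that number by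
    [G(u) ^ n] whenever [0 < u <= 1].

    _The constant 3._  Powers of progression-free sets are progression-free.
    Thus [#|B| ^ m <= 3 G(u) ^ (n m)] for all [m], which forces
    [#|B| <= G(u) ^ n].  Taking for [u] a point where [G] is minimal ends the
    proof.  *)

Set Implicit Arguments.
Unset Strict Implicit.
Unset Printing Implicit Defensive.

Import Order.TTheory GRing.Theory Num.Theory.
Local Open Scope ring_scope.

(** * The slice rank of the diagonal tensor *)

Lemma mxrank_mxsub (F : fieldType) (m n m' n' : nat) (f : 'I_m' -> 'I_m)
    (g : 'I_n' -> 'I_n) (A : 'M[F]_(m, n)) :
  (\rank (mxsub f g A) <= \rank A)%N.
Proof.
rewrite mxsubrc (leq_trans (mxrankS (rowsub_sub _ _)))//.
by rewrite -mxrank_tr trmx_mxsub -[leqRHS]mxrank_tr mxrankS// rowsub_sub.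
Qed.

(** A space of dimension [d] contains a vector with at least [d] nonzero
    coordinates: on the [d] pivot coordinates of a basis, every prescribed
    value, here the constant 1, is attained.  The support is measured by the
    rank of the diagonal matrix, the form in which it is compared below. *)
Lemma orthogonal_large_support (F : fieldType) (m n : nat) (P : 'M[F]_(m, n)) :
  exists2 v : 'rV[F]_n, v *m P^T = 0 & (n - m <= \rank (diag_mx v))%N.
Proof.
set K := row_base (kermx P^T).
have Kfull : row_full K^T by rewrite /row_full mxrank_tr; exact: row_base_free.
set f := fullrankfun Kfull.
set B := rowsub f K^T.
have Bunit : B \in unitmx by exact: fullrowsub_unit.
(* The combination of the rows of [K] that takes the value 1 at all pivots. *)
set w : 'cV[F]_(\rank (kermx P^T)) := invmx B *m const_mx 1.
have Kw i : (K^T *m w) (f i) 0 = 1.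
  have : (B *m w) i 0 = 1 by rewrite mulKVmx// mxE.
  by rewrite /B mul_rowsub_mx mxE.
exists (K^T *m w)^T.
  rewrite trmx_mul trmxK -mulmxA.
  suff -> : K *m P^T = 0 by rewrite mulmx0.
  by apply/sub_kermxP; rewrite eq_row_base.
have sub1 : mxsub f f (diag_mx (K^T *m w)^T) = 1%:M.
  apply/matrixP => i j; rewrite !mxE (inj_eq (fullrankfun_inj (rkA := Kfull))).
  case: eqP => [->|_]; last by rewrite !mulr0n.
  by move: (Kw j); rewrite mxE => ->.
apply: leq_trans (mxrank_mxsub f f _); rewrite sub1 mxrank1 mxrank_ker mxrank_tr.
by rewrite leq_sub2l// rank_leq_row.
Qed.

Section DiagonalTensor.
Variables (F : fieldType) (J S K : finType) (phi : S -> J -> F).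

(** The functions [phi s] play the part of the low-degree monomials: a product
    [f i x * g i y * h i z] with a listed factor is a piece of a slice. *)
Definition listed (u : J -> F) : bool :=
  [exists s, [forall j, u j == phi s j]].

Lemma listedP (u : J -> F) : reflect (exists s, u =1 phi s) (listed u).
Proof.
by apply: (iffP existsP) => -[s us]; exists s; [move=> j; apply/eqP/(forallP us)|
  apply/forallP => j; apply/eqP].
Qed.

Let P : 'M[F]_(#|S|, #|J|) := \matrix_(s, j) phi (enum_val s) (enum_val j).

(* A sum of products [r i x * g i y] with many terms still has small rank when
   all the [g i] come from the list: its rows lie in the span of the list. *)
Let rank_listed (k : pred K) (g : K -> J -> F) (r : K -> 'cV[F]_#|J|) :
  (forall i, k i -> listed (g i)) ->
  (\rank (\sum_(i | k i) r i *m \row_(j < #|J|) g i (enum_val j))%R <= #|S|)%N.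
Proof.
move=> gl; apply: leq_trans (rank_leq_row P); apply: mxrankS.
apply: summx_sub => i /gl/listedP[s gs]; apply: mulmx_sub.
have -> : \row_(j < #|J|) g i (enum_val j) = row (enum_rank s) P.
  by apply/rowP => j; rewrite !mxE enum_rankK gs.
exact: row_sub.
Qed.

(** Tao's lower bound for the slice rank of the diagonal tensor.  Choose [v]
    orthogonal to all the [phi s] with support at least [#|J| - #|S|], and
    contract the third variable with [v].  The terms with a listed third factor
    vanish; the others give two matrices of rank at most [#|S|], while the
    diagonal tensor becomes [diag_mx v]. *)
Lemma card_diagonal_tensor (w : K -> F) (f g h : K -> J -> F) :
  (forall i, [|| listed (f i), listed (g i) | listed (h i)]) ->
  (forall x y z, \sum_i w i * f i x * g i y * h i z = ((x == y) && (y == z))%:R) ->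
  (#|J| <= 3 * #|S|)%N.
Proof.
move=> fgh diag.
have [v vP vrank] := orthogonal_large_support P.
pose c i := w i * \sum_(j < #|J|) v 0 j * h i (enum_val j).
have c0 i : listed (h i) -> c i = 0.
  move=> /listedP[s hs].
  have /matrixP/(_ 0 (enum_rank s)) := vP; rewrite !mxE => vP0.
  rewrite /c (_ : \sum_j _ = 0) ?mulr0//.
  by rewrite -[RHS]vP0; apply: eq_bigr => j _; rewrite !mxE enum_rankK -hs.
pose colv (u : J -> F) : 'cV[F]_#|J| := \col_(j < #|J|) u (enum_val j).
pose rowv (u : J -> F) : 'rV[F]_#|J| := \row_(j < #|J|) u (enum_val j).
(* [A] is transposed in the decomposition below, so that in both matrices the
   listed factor is the row vector. *)
pose A := \sum_(i | listed (f i)) (c i *: colv (g i)) *m rowv (f i).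
pose B := \sum_(i | ~~ listed (f i) && listed (g i))
  (c i *: colv (f i)) *m rowv (g i).
have vAB : diag_mx v = A^T + B.
  apply/matrixP => x y; rewrite !mxE.
  have -> : v 0 x *+ (x == y) =
      \sum_(z < #|J|) v 0 z *
        \sum_i w i * f i (enum_val x) * g i (enum_val y) * h i (enum_val z).
    under eq_bigr => z _ do rewrite diag !(inj_eq enum_val_inj).
    have [<-|xy] /= := eqVneq x y; last first.
      by rewrite mulr0n big1// => z _; rewrite mulr0.
    rewrite (bigD1 x)//= eqxx mulr1 big1 ?addr0// => z zx.
    by rewrite eq_sym (negPf zx) mulr0.
  under eq_bigr do rewrite mulr_sumr.
  rewrite exchange_big/=.
  have E (l : K) : \sum_(z < #|J|)
      v 0 z * (w l * f l (enum_val x) * g l (enum_val y) * h l (enum_val z))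
      = c l * f l (enum_val x) * g l (enum_val y).
    rewrite /c mulr_sumr !mulr_suml; apply: eq_bigr => z _.
    by rewrite [RHS]mulrAC; ring.
  rewrite (eq_bigr _ (fun l _ => E l)).
  rewrite (bigID (listed \o f))/=; congr (_ + _).
    rewrite /A summxE; apply: eq_bigr => l _.
    by rewrite !mxE big_ord1 !mxE mulrAC.
  rewrite (bigID (listed \o g))/= [X in _ + X]big1 ?addr0.
    by rewrite /B summxE; apply: eq_bigr => l _; rewrite !mxE big_ord1 !mxE.
  move=> i /andP[nf ng]; rewrite c0 ?mul0r//.
  by have := fgh i; rewrite (negPf nf) (negPf ng).
have Ar : (\rank A <= #|S|)%N by exact: rank_listed.
have Br : (\rank B <= #|S|)%N by apply: rank_listed => i /andP[].
have : (#|J| - #|S| <= #|S| + #|S|)%N.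
  apply: leq_trans vrank _; rewrite vAB; apply: leq_trans (mxrank_add _ _) _.
  by rewrite mxrank_tr leq_add.
by rewrite leq_subLR !mulSn mul0n addn0.
Qed.
End DiagonalTensor.

(** * The polynomial method for progression-free families *)

Lemma trinomial_expansion (R : comNzRingType) (h : nat) :
  exists (K : finType) (w : K -> R) (a b c : K -> nat),
    (forall k, a k + b k + c k <= h)%N /\
    (forall x y z, (x + y + z) ^+ h = \sum_k w k * x ^+ a k * y ^+ b k * z ^+ c k).
Proof.
pose K : finType := {i : 'I_h.+1 & 'I_(h - i).+1}.
pose i (k : K) : nat := tag k; pose j (k : K) : nat := tagged k.
exists K, (fun k => 'C(h, i k)%:R * 'C(h - i k, j k)%:R).
exists (fun k => h - i k - j k)%N, j, i; split=> [k|x y z].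
  by rewrite !subnK// -ltnS /i /j.
transitivity (\sum_(i < h.+1) \sum_(j < (h - i).+1) 'C(h, i)%:R * 'C(h - i, j)%:R
    * x ^+ (h - i - j) * y ^+ j * z ^+ i); last by rewrite sig_big_dep.
rewrite exprDn; apply: eq_bigr => l _; rewrite exprDn mulr_suml -sumrMnl.
apply: eq_bigr => m _; rewrite -[LHS]mulr_natr -[_ *+ 'C(h - l, m)]mulr_natr.
move: 'C(h, l)%:R 'C(h - l, m)%:R (x ^+ _) (y ^+ _) (z ^+ _) => r s u v t.
by ring.
Qed.

(** By Fermat's little theorem [1 - t ^ (q - 1)] is the indicator of [t = 0];
    take [t = x + y - 2z] and expand. *)
Lemma coordinate_expansion (F : finFieldType) :
  exists (K : finType) (w : K -> F) (a b c : K -> nat),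
    (forall k, a k + b k + c k <= #|F|.-1)%N /\
    (forall x y z, (x + y == z *+ 2)%:R
       = \sum_k w k * x ^+ a k * y ^+ b k * z ^+ c k).
Proof.
have [K [w [a [b [c [deg xyz]]]]]] := trinomial_expansion F #|F|.-1.
pose add_cst (f : K -> nat) (k : unit + K) := if k is inr k' then f k' else 0%N.
(* The extra index [inl tt] carries the constant term 1. *)
exists (unit + K)%type, (fun k => if k is inr k' then - (w k' * (- 2%:R) ^+ c k') else 1).
exists (add_cst a), (add_cst b), (add_cst c); split=> [[//|k /=]|x y z].
  exact: deg.
rewrite big_sumType /= big_const card_unit /= addr0 !expr0 !mulr1.
have -> : (x + y == z *+ 2)%:R = 1 - (x + y + (- 2%:R) * z) ^+ #|F|.-1.
  have [->|xyz0] := eqVneq; rewrite /=.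
    rewrite (_ : z *+ 2 + (- 2%:R) * z = 0); last by ring.
    by rewrite expr0n gtn_eqF ?subr0// -subn1 subn_gt0 finNzRing_gt1.
  have xyz1 : x + y + (- 2%:R) * z != 0.
    by apply: contra xyz0; rewrite -[_ == z *+ 2]subr_eq0 => /eqP <-; apply/eqP; ring.
  apply/eqP; rewrite eq_sym subr_eq0 eq_sym; apply/eqP; apply: (mulfI xyz1).
  by rewrite -exprS prednK ?expf_card ?mulr1// (cardD1 0).
congr (_ + _); rewrite xyz -sumrN; apply: eq_bigr => k _.
by rewrite exprMn; ring.
Qed.

(** Exponents of the monomials of degree at most [h #|I| / 3] in variables
    indexed by [I], with each partial degree at most [h]. *)
Definition low_degree (I : finType) (h : nat) : {set {ffun I -> 'I_h.+1}} :=
  [set a : {ffun I -> 'I_h.+1} | (3 * \sum_i a i <= h * #|I|)%N].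

(** The points are given as a family [pt] on arbitrary finite types, so that
    powers of the family (indexed by finite functions, with coordinates
    indexed by a product) are again of this form.  The hypothesis turns the
    polynomial indicator of progressions into the diagonal tensor; among three
    exponents of total degree at most [h #|I|] one is low. *)
Lemma progression_free_family (F : finFieldType) (I J : finType)
    (pt : J -> I -> F) :
  (forall x y z, (forall i, pt x i + pt y i = pt z i *+ 2) -> x = y /\ y = z) ->
  (#|J| <= 3 * #|low_degree I #|F|.-1|)%N.
Proof.
move=> free; set h := #|F|.-1.
have [K [w [a [b [c [deg expand]]]]]] := coordinate_expansion F.
pose S : finType := {s | s \in low_degree I h}.
pose mono (e : I -> nat) (j : J) := \prod_i pt j i ^+ e i.
pose phi (s : S) := mono (fun i => nat_of_ord (val s i)).
have lowP (e : I -> nat) : (forall i, e i <= h)%N ->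
    (3 * \sum_i e i <= h * #|I|)%N -> listed phi (mono e).
  move=> eh elow; pose s := [ffun i => inord (e i) : 'I_h.+1].
  have sE i : s i = e i :> nat by rewrite ffunE inordK// ltnS.
  have slow : s \in low_degree I h.
    by rewrite inE; under eq_bigr do rewrite sE.
  apply/listedP; exists (Sub s slow) => j.
  by apply: eq_bigr => i _; rewrite SubK sE.
have -> : #|low_degree I h| = #|S| by rewrite card_sig.
apply: (@card_diagonal_tensor F J S {ffun I -> K} phi
  (fun k => \prod_i w (k i)) (fun k => mono (a \o k)) (fun k => mono (b \o k))
  (fun k => mono (c \o k))) => [k|x y z].
  have degI : (\sum_i a (k i) + \sum_i b (k i) + \sum_i c (k i) <= h * #|I|)%N.
    by rewrite -!big_split/= mulnC -sum_nat_const leq_sum.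
  have deg3 i : [/\ a (k i) <= h, b (k i) <= h & c (k i) <= h]%N.
    by have := deg (k i); rewrite -/h; split; lia.
  have [|na] := leqP (3 * \sum_i a (k i)) (h * #|I|).
    by move=> /lowP -> // i; case: (deg3 i).
  have [|nb] := leqP (3 * \sum_i b (k i)) (h * #|I|).
    by move=> /lowP -> //; rewrite ?orbT// => i; case: (deg3 i).
  rewrite (lowP (c \o k)) ?orbT//; first by move=> i; case: (deg3 i).
  move: degI na nb => /=.
  move: (\sum_i a (k i))%N (\sum_i b (k i))%N (\sum_i c (k i))%N (h * #|I|)%N.
  by move=> sa sb sc s; lia.
transitivity (\prod_i (pt x i + pt y i == pt z i *+ 2)%:R : F).
  rewrite (eq_bigr _ (fun i _ => expand _ _ _)) bigA_distr_bigA/=.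
  by apply: eq_bigr => k _; rewrite /mono -!big_split.
have [/forallP xyz|nxyz] := boolP [forall i, pt x i + pt y i == pt z i *+ 2].
  rewrite big1 => [|i _]; last by rewrite xyz.
  by have [|<- <-] := free x y z; [move=> i; exact/eqP | rewrite eqxx].
have [i ni] := forallPn nxyz; rewrite (bigD1 i)//= (negPf ni) mul0r.
case: eqP => //= xy; case: eqP => //= yz.
by rewrite xy yz mulr2n eqxx in ni.
Qed.

(** * Independent sets in sparse digraphs *)

(** The average indegree equals the average outdegree, hence some vertex has
    indegree, as well as outdegree, at most [d].  Keep it, discard its at most
    [2d] neighbours, and continue in what remains, where the outdegree bound
    still holds. *)
Lemma sparse_digraph_independent_set (T : finType) (e : rel T) (d : nat)
    (A : {set T}) :
  (forall x, x \in A -> #|[set y in A | e x y]| <= d)%N ->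
  exists B : {set T}, [/\ B \subset A,
    forall x y, x \in B -> y \in B -> x != y -> ~~ e x y &
    (#|A| <= (2 * d).+1 * #|B|)%N].
Proof.
have [m] := ubnP #|A|; elim: m => // m IH in A * => /ltnSE-Am outA.
have [->|An0] := eqVneq A set0.
  by exists set0; split=> [|x y|]; rewrite ?sub0set ?inE// !cards0.
have [y yA indeg] : exists2 y, y \in A & (#|[set x in A | e x y]| <= d)%N.
  apply/exists_inP; apply: contraPT An0 => /exists_inPn big_indeg.
  apply/negP; rewrite negbK -cards_eq0 -leqn0 leqNgt; apply/negP => A0.
  have : (\sum_(x in A) #|[set y in A | e x y]| <= #|A| * d)%N.
    by rewrite -sum_nat_const leq_sum.
  have -> : (\sum_(x in A) #|[set y in A | e x y]|
      = \sum_(y in A) #|[set x in A | e x y]|)%N.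
    under eq_bigr do rewrite -sum1dep_card.
    rewrite (exchange_big_dep (mem A))/=; last by move=> x y _ /andP[].
    apply: eq_bigr => y yA; rewrite sum1dep_card; congr #|pred_of_set _|.
    by apply/setP => x; rewrite !inE yA.
  apply/negP; rewrite -ltnNge; apply: leq_trans (_ : #|A| * d.+1 <= _)%N.
    by rewrite ltn_pmul2l.
  by rewrite -sum_nat_const leq_sum// => y /big_indeg; rewrite -ltnNge.
pose N := [set x in A | e y x] :|: [set x in A | e x y].
pose A' := A :\: (y |: N).
have A'A : A' \subset A by exact: subsetDl.
have [||B [BA' Bind Bcard]] := IH A'.
- apply: leq_trans Am; apply: proper_card; rewrite properE A'A/=.
  by apply/subsetPn; exists y => //; rewrite !inE eqxx.
- move=> x /(subsetP A'A)/outA; apply: leq_trans; apply: subset_leq_card.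
  by apply/subsetP => z; rewrite !inE => /andP[/andP[_ ->] ->].
have yB : y \notin B by apply/negP => /(subsetP BA'); rewrite !inE eqxx.
have noy x : x \in B -> ~~ e x y && ~~ e y x.
  by move=> /(subsetP BA'); rewrite !inE => /andP[+ xA]; rewrite xA;
     case: (e x y); case: (e y x); rewrite ?orbT.
exists (y |: B); split.
- by rewrite subUset sub1set yA (subset_trans BA').
- move=> x z /setU1P[->|xB] /setU1P[->|zB] xz; last exact: Bind.
  + by rewrite eqxx in xz.
  + by case/andP: (noy z zB).
  + by case/andP: (noy x xB).
have Ncard : (#|N| <= 2 * d)%N.
  rewrite mul2n -addnn; apply: leq_trans (leq_card_setU _ _) _.
  by rewrite leq_add// outA.
rewrite cardsU1 yB mulnS -(cardsID (y |: N) A) leq_add//.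
apply: leq_trans (subset_leq_card (subsetIr _ _)) _.
apply: leq_trans (leq_card_setU _ _) _.
by rewrite cards1 add1n ltnS.
Qed.

(** * Counting monomials and the tensor power argument *)

(** The usual exponential-moment bound: expanding [(1 + u + ... + u ^ h) ^ #|I|]
    gives one term [u ^ deg] per monomial, and as [u <= 1] each low-degree
    monomial contributes at least [u ^ (h #|I| / 3)]. *)
Lemma card_low_degree (R : realType) (I : finType) (h : nat) (u : R) :
  0 < u <= 1 -> #|low_degree I h|%:R <= Gfun 1 (1 / 3 : R) h u ^+ #|I|.
Proof.
move=> u01; have /andP[u0 u1] := u01.
rewrite /Gfun mul1n exprMn; set s : R := 1 / 3 * h%:R.
have -> : (\sum_(j < h.+1) u ^+ j) ^+ #|I|
    = \sum_(a : {ffun I -> 'I_h.+1}) u ^+ (\sum_i a i).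
  rewrite -prodr_const (bigA_distr_bigA (fun (_ : I) (j : 'I_h.+1) => u ^+ j)).
  by apply: eq_bigr => a _; rewrite expr_sum.
rewrite mulr_sumr -sum1_card natr_sum.
apply: le_trans (_ : \sum_(a in low_degree I h)
    (u `^ (- s)) ^+ #|I| * u ^+ (\sum_i a i) <= _); last first.
  rewrite [leRHS](bigID (mem (low_degree I h)))/= lerDl sumr_ge0// => a _.
  by rewrite mulr_ge0// exprn_ge0// ?powR_ge0// ltW.
apply: ler_sum => a; rewrite inE => alow.
rewrite -(powR_mulrn _ (powR_ge0 _ _)) -powRrM -(powR_mulrn _ (ltW u0)).
rewrite -powRD ?(gt_eqF u0) ?implybT// -[leLHS](powRr0 u) ger_powR//.
rewrite mulNr addrC subr_le0 /s mulrAC mulrC -(ler_pM2l (_ : 0 < 3)) ?ltr0n//.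
rewrite !mulrA (_ : 3 * h%:R * 1 / 3 = h%:R :> R); last by field.
by rewrite -!natrM ler_nat.
Qed.

Lemma le_of_powers (R : realType) (C x c : R) :
  0 <= c -> (forall m, x ^+ m <= C * c ^+ m) -> x <= c.
Proof.
move=> c0 xm; rewrite leNgt; apply/negP => cx.
have x0 : 0 < x by exact: le_lt_trans cx.
have z1 : `|c / x| < 1 by rewrite ger0_norm ?divr_ge0// ?ltr_pdivrMr ?mul1r// ltW.
suff : (1 : R) <= 0 by rewrite ler10.
apply: (cvgr_to_ge (cvg_geometric C z1)); near=> m.
by rewrite /= expr_div_n mulrA ler_pdivlMr ?exprn_gt0// mul1r.
Unshelve. all: by end_near. Qed.

(** The factor 3 disappears on applying the slice-rank bound to all powers of
    the family. *)
Lemma progression_free_family_Gfun (R : realType) (F : finFieldType)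
    (I J : finType) (pt : J -> I -> F) (u : R) :
  (forall x y z, (forall i, pt x i + pt y i = pt z i *+ 2) -> x = y /\ y = z) ->
  0 < u <= 1 -> #|J|%:R <= Gfun 1 (1 / 3 : R) #|F|.-1 u ^+ #|I|.
Proof.
move=> free u01; set g := Gfun _ _ _ _.
have g0 : 0 <= g.
  rewrite mulr_ge0 ?powR_ge0// sumr_ge0// => i _; rewrite exprn_ge0//.
  by have /andP[/ltW] := u01.
apply: (@le_of_powers _ 3); first by rewrite exprn_ge0.
move=> m.
pose ptm (f : {ffun 'I_m -> J}) (si : 'I_m * I) := pt (f si.1) si.2.
have freem x y z :
    (forall si, ptm x si + ptm y si = ptm z si *+ 2) -> x = y /\ y = z.
  move=> xyz; have E s : x s = y s /\ y s = z s.
    by apply: free => i; exact: (xyz (s, i)).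
  by split; apply/ffunP => s; case: (E s).
have := progression_free_family freem.
rewrite card_ffun card_ord -(ler_nat R) natrX natrM => /le_trans; apply.
rewrite ler_wpM2l ?ler0n//; apply: le_trans (card_low_degree _ _ u01) _.
by rewrite card_prod card_ord mulnC exprM.
Qed.

(** * Stars and progressions *)

(** The arcs from a centre [x]: of the two ends [y] and [2x - y] of a pair
    centred at [x], only the one enumerated first is reached, so that
    outneighbours correspond to pairs.  The strict inequality also excludes the
    degenerate pair [y = 2x - y]. *)
Definition lesser_end (p n : nat) (A : {set 'rV['F_p]_n}) :
    rel 'rV['F_p]_n :=
  fun x y => (x *+ 2 - y \in A) && (enum_rank y < enum_rank (x *+ 2 - y)%R)%N.

(** Outneighbours [y] of [x] lie in pairwise disjoint pairs [{y, 2x - y}], none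
    of which contains [x], so [k] of them would make a star centred at [x]. *)
Lemma star_free_outdegree (p n k : nat) (A : {set 'rV['F_p]_n})
    (x : 'rV['F_p]_n) :
  (0 < k)%N -> star_free k A -> x \in A ->
  (#|[set y in A | lesser_end A x y]| <= k.-1)%N.
Proof.
move=> k0 Afree xA; rewrite leqNgt prednK//; apply/negP => kN; apply: Afree.
set N := [set y in A | lesser_end A x y] in kN.
pose y j := nth 0 (enum N) j.
have yN j : (j < k)%N -> y j \in N.
  by move=> jk; rewrite -mem_enum mem_nth// -cardE (leq_trans jk).
have yA j : (j < k)%N -> y j \in A by move=> /yN; rewrite inE => /andP[].
have yA' j : (j < k)%N -> x *+ 2 - y j \in A.
  by move=> /yN; rewrite inE => /and3P[].
have ylt j : (j < k)%N -> (enum_rank (y j) < enum_rank (x *+ 2 - y j)%R)%N.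
  by move=> /yN; rewrite inE => /and3P[].
have yinj i j : (i < k)%N -> (j < k)%N -> y i = y j -> i = j.
  move=> ik jk /eqP; rewrite nth_uniq ?enum_uniq -?cardE ?(leq_trans ik)//.
    by move/eqP.
  by rewrite (leq_trans jk).
pose entry i := if i == (2 * k)%N then x
  else if odd i then x *+ 2 - y i./2 else y i./2.
have half_lt i : (i < (2 * k).+1)%N -> i != (2 * k)%N -> (i./2 < k)%N by lia.
(* The entries are distinct because [y j] is enumerated strictly before its
   partner: equalities across two pairs would reverse this order. *)
have yx j : (j < k)%N -> y j <> x.
  by move=> /ylt + E; rewrite E mulr2n addrK ltnn.
have yx' j : (j < k)%N -> x *+ 2 - y j <> x.
  by move=> jk /eqP; rewrite mulr2n -addrA -subr_eq0 addrAC subrr add0r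
    subr_eq0 => /eqP/esym; exact: yx.
have yy' i j : (i < k)%N -> (j < k)%N -> y i <> x *+ 2 - y j.
  move=> /ylt + /ylt + E; rewrite -E.
  rewrite (_ : x *+ 2 - y i = y j); last by rewrite E subKr.
  by move=> /ltn_trans lt /lt; rewrite ltnn.
have entry_inj : {in gtn (2 * k).+1 &, injective entry}.
  move=> i j; rewrite !inE => ik jk; rewrite /entry.
  case: eqP => [->|/eqP/(half_lt _ ik) ik2]; case: eqP => [->|/eqP/(half_lt _ jk) jk2] //.
  - by case: ifP => _ /esym; [move/(yx' _ jk2)|move/(yx _ jk2)].
  - by case: ifP => _; [move/(yx' _ ik2)|move/(yx _ ik2)].
  have [oi|oi] := boolP (odd i); have [oj|oj] := boolP (odd j) => E.
  - have /addrI/oppr_inj/(yinj _ _ ik2 jk2) := E.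
    by rewrite -[in i = _](odd_double_half i) -[in _ = j](odd_double_half j) oi oj => ->.
  - by case: (yy' _ _ jk2 ik2).
  - by case: (yy' _ _ ik2 jk2).
  - have := yinj _ _ ik2 jk2 E.
    by rewrite -[in i = _](odd_double_half i) -[in _ = j](odd_double_half j)
      (negPf oi) (negPf oj) => ->.
exists (mktuple (fun i : 'I_(2 * k).+1 => entry i)).
have nthE i : (i < (2 * k).+1)%N ->
    (mktuple (fun i : 'I_(2 * k).+1 => entry i))`_i = entry i.
  by move=> ik; rewrite -[i]/(nat_of_ord (Ordinal ik)) -tnth_nth tnth_mktuple.
split=> [i|].
  rewrite tnth_mktuple /entry; case: eqP => // /eqP/(half_lt _ (ltn_ord i)) i2.
  by case: ifP => _; [exact: yA'|exact: yA].
split=> [|j jk].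
  rewrite map_inj_uniq ?enum_uniq// => i j E; apply/val_inj.
  by apply: entry_inj E; rewrite inE ltn_ord.
rewrite (nthE (2 * j)%N) ?(nthE (2 * j).+1) ?(nthE (2 * k)%N); do ?[lia].
rewrite /entry eqxx !ltn_eqF; do ?[lia].
rewrite /= oddM mul2n/= uphalf_double doubleK.
by rewrite [y j + _]addrC subrK subrr.
Qed.

(** One of the two ends of a nontrivial progression is an outneighbour of its
    middle term.  Oddness of [p] is what makes the middle term of [x, x] equal
    to [x]. *)
Lemma independent_progression_free (p n : nat) (A B : {set 'rV['F_p]_n}) :
  prime p -> odd p -> B \subset A ->
  (forall x y, x \in B -> y \in B -> x != y -> ~~ lesser_end A x y) ->
  forall x y z, x \in B -> y \in B -> z \in B ->
  x + y = z *+ 2 -> x = y /\ y = z.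
Proof.
move=> p_prime p_odd BA ind x y z xB yB zB xyz.
have two_inj (v w : 'rV['F_p]_n) : v *+ 2 = w *+ 2 -> v = w.
  move=> /rowP vw; apply/rowP => i; have := vw i; rewrite !mulmxnE.
  rewrite -[LHS]mulr_natr -[RHS]mulr_natr; apply: mulIf.
  rewrite -(dvdn_pcharf (pchar_Fp p_prime)).
  by rewrite dvdn_prime2//; apply: contraTN p_odd => /eqP ->.
have xE : x = z *+ 2 - y by rewrite -xyz addrK.
have yE : y = z *+ 2 - x by rewrite -xyz addrC addKr.
have [xy|nxy] := eqVneq x y.
  by split=> //; apply: two_inj; rewrite -xyz xy.
have nzx : z != x.
  by apply: contra nxy => /eqP zx; rewrite [y]yE zx mulr2n addrK.
have nzy : z != y.
  by apply: contra nxy => /eqP zy; rewrite [x]xE zy mulr2n addrK.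
have := ind z x zB xB nzx; have := ind z y zB yB nzy.
rewrite /lesser_end -yE -xE !(subsetP BA)//=.
have [] := ltngtP (enum_rank x) (enum_rank y) => // /val_inj/enum_rank_inj E.
by rewrite E eqxx in nxy.
Qed.

Theorem theorem1p1 (R : realType) (p n k : nat)
  (p_prime : prime p) (p_ge3 : (3 <= p)%N) (n_ge1 : (1 <= n)%N) (k_ge1 : (1 <= k)%N)
  (A : {set 'rV['F_p]_n}) (A_free : star_free k A) :
  #|A|%:R <= (k ^ 2)%:R * Lambda 1 (1 / 3 : R) (p - 1) ^+ n.
Proof.
have [B [BA Bind ABcard]] := sparse_digraph_independent_set
  (fun x xA => star_free_outdegree k_ge1 A_free xA).
have p_odd : odd p by case: (even_prime p_prime) p_ge3 => // ->.
have Bfree := independent_progression_free p_prime p_odd BA Bind.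
have [|u [u01 -> _]] := @Lambda_min R 1 (1 / 3) (p - 1); first by rewrite divr_gt0.
have Bcard : #|B|%:R <= Gfun 1 (1 / 3 : R) (p - 1) u ^+ n.
  pose J : finType := {x | x \in B}.
  pose pt (x : J) (i : 'I_n) := val x 0 i.
  have ptfree x y z :
      (forall i, pt x i + pt y i = pt z i *+ 2) -> x = y /\ y = z.
    move=> xyz.
    have [|xy yz] := Bfree _ _ _ (valP x) (valP y) (valP z).
      by apply/rowP => i; rewrite mulmxnE mxE; exact: xyz.
    by split; exact: val_inj.
  have := progression_free_family_Gfun ptfree u01.
  by rewrite card_sig card_Fp// -subn1 card_ord.
apply: le_trans (_ : (k ^ 2)%:R * #|B|%:R <= _); last first.
  by rewrite ler_wpM2l ?ler0n.
rewrite -natrM ler_nat; apply: leq_trans ABcard _; rewrite leq_mul2r.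
by apply/orP; right; nia.
Qed.
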